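(* For every integer $a\ge1$, $\phi(p_{a,0})=(t-1)^a-(-1)^a$.
   Context: $p_{a,b}=\sum_{i\in\mathbb{Z}}x_i^ax_{-i}^b$ in commuting variables $x_i$, $i\in\mathbb{Z}$. A signed graph is a finite graph (loops and multiple edges allowed) with $\mathrm{sgn}:E\to\{+,-\}$; a coloring $\kappa:V\to\mathbb{Z}$ is proper if $\kappa(u)\ne\mathrm{sgn}(e)\kappa(v)$ for every edge $e$ with endpoints $u,v$. An orientation assigns to each half-edge (a loop has two) an arrow toward or away from the vertex, such that on a positive edge exactly one of the two arrows points toward its vertex and on a negative edge both point toward or both point away. A cycle is a closed walk in which, considering only the edges of the walk, every vertex of the walk has at least one arrow pointing into it and one pointing out of it; an orientation is acyclic if it has no cycle; a sink is a vertex all of whose incident arrows point toward it (an isolated vertex is a sink). A signed poset is an acyclic orientation $P$ of a signed graph. A proper coloring $\kappa$ preserves $P$ if for every edge $e$ and each endpoint $v$ of $e$, with $u$ the other endpoint ($u=v$ for a loop), the arrow of $P$ at the incidence of $e$ with $v$ points toward $v$ iff $\kappa(v)>\mathrm{sgn}(e)\kappa(u)$. $Y_P=\sum_\kappa\prod_v x_{\kappa(v)}$ over proper colorings preserving $P$; $\mathbb{Y}$ is the $\mathbb{Q}$-span of all $Y_P$ (it is closed under products and contains $p_{a,b}$ for $a\ge1,b\ge0$ and $x_0$). $\phi:\mathbb{Y}\to\mathbb{Q}[t]$ is the (unique) $\mathbb{Q}$-linear map with $\phi(Y_P)=t^{\mathrm{sink}(P)}$, $\mathrm{sink}(P)$ the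 number of sinks of $P$ (its existence is established in the paper). *)

(* Defs.v *)
From mathcomp Require Import all_boot all_order all_algebra.
Set Implicit Arguments. Unset Strict Implicit. Unset Printing Implicit Defensive.
Import Order.TTheory GRing.Theory Num.Theory.
Local Open Scope ring_scope.

(* An edge of a signed graph on vertex set 'I_n, together with its orientation.
   Endpoints e_u, e_v (e_u = e_v for a loop); e_pos = true iff sgn(e) = +.
   e_au (resp. e_av) = true iff the arrow at the half-edge incident to e_u
   (resp. e_v) points toward that vertex. *)
Record sedge (n : nat) := SEdge {
  e_u : 'I_n; e_v : 'I_n; e_pos : bool; e_au : bool; e_av : bool }.

Record ograph := OGraph {
  og_n : nat; og_m : nat; og_edge : 'I_og_m -> sedge og_n }.
Arguments og_edge : clear implicits.

Definition sgnz (b : bool) : int := if b then 1 else -1.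

Definition is_orientation (P : ograph) : bool :=
  [forall j, e_pos (og_edge P j) == (e_au (og_edge P j) != e_av (og_edge P j))].

Definition connects n (e : sedge n) (x y : 'I_n) : bool :=
  ((e_u e == x) && (e_v e == y)) || ((e_u e == y) && (e_v e == x)).

Definition points_in n (e : sedge n) (v : 'I_n) : bool :=
  ((e_u e == v) && e_au e) || ((e_v e == v) && e_av e).
Definition points_out n (e : sedge n) (v : 'I_n) : bool :=
  ((e_u e == v) && ~~ e_au e) || ((e_v e == v) && ~~ e_av e).

Definition closed_walk (P : ograph) (w : seq ('I_(og_n P) * 'I_(og_m P) * 'I_(og_n P))) :=
  w != [::] /\
  cycle (fun s t : 'I_(og_n P) * 'I_(og_m P) * 'I_(og_n P) => s.2 == t.1.1) w /\
  all (fun s => connects (og_edge P s.1.2) s.1.1 s.2) w.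

Definition is_cycle (P : ograph) (w : seq ('I_(og_n P) * 'I_(og_m P) * 'I_(og_n P))) :=
  closed_walk w /\
  forall v, v \in [seq s.1.1 | s <- w] ->
    (exists2 s, s \in w & points_in (og_edge P s.1.2) v) /\
    (exists2 s, s \in w & points_out (og_edge P s.1.2) v).

Definition acyclic (P : ograph) := forall w, ~ is_cycle (P := P) w.

Definition signed_poset (P : ograph) := is_orientation P /\ acyclic P.

Definition is_sink (P : ograph) (v : 'I_(og_n P)) : bool :=
  [forall j, ((e_u (og_edge P j) == v) ==> e_au (og_edge P j)) &&
             ((e_v (og_edge P j) == v) ==> e_av (og_edge P j))].

Definition nsinks (P : ograph) : nat := #|[pred v | @is_sink P v]|.

Definition good_coloring (P : ograph) (kappa : 'I_(og_n P) -> int) : bool :=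
  [forall j, let e := og_edge P j in
     (kappa (e_u e) != sgnz (e_pos e) * kappa (e_v e)) &&
     (e_au e == (sgnz (e_pos e) * kappa (e_v e) < kappa (e_u e))) &&
     (e_av e == (sgnz (e_pos e) * kappa (e_u e) < kappa (e_v e)))].

(* Formal power series in the x_i (i : int) are represented by their
   coefficient function on monomials; a monomial x_{i_1}...x_{i_k} is
   represented by any list [:: i_1; ...; i_k] (all functions below are
   invariant under permutation of the list). *)
Definition series := seq int -> rat.

(* coefficient of the monomial s in Y_P: number of good colorings kappa
   with multiset of values equal to s *)
Definition Ycoef (P : ograph) : series := fun s =>
  if size s == og_n P then
    (count (fun l => good_coloring (P := P) (fun i => nth 0 l i)) (permutations s))%:R
  else 0.

(* coefficient of monomial s in p_{a,b} = sum_i x_i^a x_{-i}^b  (for a + b >= 1,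
   the relevant i necessarily occur in s or -s) *)
Definition pab (a b : nat) : series := fun s =>
  (count (fun i => perm_eq s (nseq a i ++ nseq b (- i)))
         (undup (s ++ map (fun i => - i) s)))%:R.

Definition represents (r : seq (rat * ograph)) (f : series) :=
  foldr (fun x (Q : Prop) => signed_poset x.2 /\ Q) True r /\
  forall s, f s = \sum_(x <- r) x.1 * Ycoef x.2 s.

Definition phi_comb (r : seq (rat * ograph)) : {poly rat} :=
  \sum_(x <- r) x.1 *: 'X^(nsinks x.2).

(* Main.v *)
Require Import Defs.
From mathcomp Require Import all_boot all_order all_algebra zify ring.
From Stdlib Require Import Classical.
Set Implicit Arguments. Unset Strict Implicit. Unset Printing Implicit Defensive.
Import Order.TTheory GRing.Theory Num.Theory.
Local Open Scope ring_scope.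

(* Write N_m(A) for the number of good colorings, with values in [-m, m], of the
   graph induced on A. In a good coloring with values in [-m-1, m+1] the vertices
   colored m+1 are sinks, those colored -m-1 are sources, and any set of sinks and
   disjoint set of sources can be so colored. Hence N_(m+1)(A) is a sum of terms
   N_m(A'), N_m(A) is polynomial in m, and induction gives N_(-1)(A) = (-1)^|A|,
   acyclicity providing a vertex that is a sink or a source but not both. Since
   t^sink(P) is the sum of (t - 1)^|S| over the sets S of sinks of P, it is
   (-1)^n times the value at m = -1 of the sum of (1 - t)^#{k = m+1} over the good
   colorings k with values in [-m, m+1]. This is a linear function of the
   coefficients of Y_P; on p_{a,0} it is the value at m = -1 of
   (-1)^a (2m + 1 + (1 - t)^a). Conversely p_{a,0} is in the span because the
   indicator of k 1 = ... = k a is a product of factors 1 - [k i < k j] - [k i > k j]. *)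

(** * Half-edges and colorings of induced graphs *)

(* A half-edge is a pair (j, b): the end of edge j at e_u if b, at e_v otherwise. *)
Definition hsrc (P : ograph) (h : 'I_(og_m P) * bool) : 'I_(og_n P) :=
  if h.2 then e_u (og_edge P h.1) else e_v (og_edge P h.1).
Definition harr (P : ograph) (h : 'I_(og_m P) * bool) : bool :=
  if h.2 then e_au (og_edge P h.1) else e_av (og_edge P h.1).
Definition hopp (P : ograph) (h : 'I_(og_m P) * bool) := (h.1, ~~ h.2).
Definition flip (d : bool) (x : int) := if d then x else - x.
Definition hval (P : ograph) (k : 'I_(og_n P) -> int) h := flip (harr h) (k (hsrc h)).
Definition within (P : ograph) (A : {set 'I_(og_n P)}) (j : 'I_(og_m P)) :=
  (hsrc (j, true) \in A) && (hsrc (j, false) \in A).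
Definition good_on (P : ograph) (A : {set 'I_(og_n P)}) (k : 'I_(og_n P) -> int) :=
  [forall j, within A j ==> (0 < hval k (j, true) + hval k (j, false))].
(* v is a sink (d = true) or a source (d = false) of the graph induced on A. *)
Definition extremal (P : ograph) (A : {set 'I_(og_n P)}) (d : bool) v :=
  [forall h, within A h.1 && (hsrc h == v) ==> (harr h == d)].

(** For either sign of an edge, the orientation condition reduces properness and both arrow
    conditions to one strict linear inequality between the endpoint colors, signed by their
    arrows. *)
Lemma good_coloringE (P : ograph) (k : 'I_(og_n P) -> int) :
  is_orientation P -> good_coloring k = good_on setT k.
Proof.
move=> /forallP oP; apply: eq_forallb => j; rewrite /within !inE /= /hval /harr /hsrc /=.
move: (oP j); case: (og_edge P j) => u v p b c /=.
by case: p; case: b; case: c => //= _; rewrite /sgnz; lia.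
Qed.

Lemma good_onP (P : ograph) A (k : 'I_(og_n P) -> int) :
  reflect (forall h, within A h.1 -> 0 < hval k h + hval k (hopp h)) (good_on A k).
Proof.
apply: (iffP forallP) => [H [j b] /= wj|H j]; last first.
  by apply/implyP => wj; exact: (H (j, true)).
by move: (H j); rewrite wj /= /hopp; case: b => //=; rewrite addrC.
Qed.

Lemma within_hsrc (P : ograph) (A : {set 'I_(og_n P)}) h : within A h.1 -> hsrc h \in A.
Proof. by case: h => j [] /andP[]. Qed.

Lemma sinkE (P : ograph) v : @is_sink P v = extremal setT true v.
Proof.
apply/forallP/forallP => [H [j b]|H j].
  rewrite /within !inE /=; move: (H j) => /andP[].
  by rewrite /hsrc /harr; case: b => /= ? ?; rewrite eqb_id.
move: (H (j, true)) (H (j, false)).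
by rewrite /within !inE /hsrc /harr /= !eqb_id => -> ->.
Qed.

(** * Acyclicity: colorable orientations and extremal vertices *)

Lemma iter_periodic (T : finType) (f : T -> T) x :
  exists i n, iter n.+1 f (iter i f x) = iter i f x.
Proof.
have /trajectP[i Hi E] := looping_order f x.
exists i, ((order f x).-1 - i)%N.
by rewrite -iterD -E; congr (iter _ f x); move: (order_gt0 f x); lia.
Qed.

(* At a vertex of the walk where |k| is maximal, all arrows of the walk agree
   with the sign of k. *)
Lemma good_on_acyclic (P : ograph) (k : 'I_(og_n P) -> int) : good_on setT k -> acyclic P.
Proof.
move=> /good_onP gk w [[w0 [cw aw]] H].
case: w w0 cw aw H => // s w _ cw aw H.
set W := s :: w in cw aw H.
have Hs : exists2 v, v \in [seq s.1.1 | s <- W] &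
   forall u, u \in [seq s.1.1 | s <- W] -> (`|k u| <= `|k v|)%N.
  have v0 : s.1.1 \in [pred u | u \in [seq s.1.1 | s <- W]] by rewrite !inE eqxx.
  case: (@arg_maxnP _ s.1.1 [pred u | u \in [seq s.1.1 | s <- W]] (fun u => `|k u|%N) v0).
  by move=> v vW Hv; exists v.
case: Hs => v vW Hv.
have ends t : t \in W -> t.1.1 \in [seq s.1.1 | s <- W] /\ t.2 \in [seq s.1.1 | s <- W].
  move=> tW; split; first exact: (map_f (fun s => s.1.1)).
  have := next_cycle cw tW => /eqP ->; apply: (map_f (fun s => s.1.1)); by rewrite mem_next.
have hends h t : t \in W -> h.1 = t.1.2 -> (`|k (hsrc h)| <= `|k v|)%N.
  move=> tW Eh; apply: Hv; have [m1 m2] := ends _ tW.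
  move/allP: aw => /(_ _ tW); rewrite /connects -Eh /hsrc; by case: ifP => _ /orP[] /andP[/eqP E1 /eqP E2]; rewrite ?E1 ?E2.
(* The opposite end contributes at most [|k v|] in absolute value, so a positive sum rules out the
   value [- |k v|] at [h] unless [k v = 0]. *)
have key h t : t \in W -> h.1 = t.1.2 -> hsrc h = v -> flip (harr h) (k v) > 0 \/ k v = 0.
  move=> tW Eh Ev; have := gk h; rewrite /within !inE /hval /= Ev => /(_ isT).
  have := hends (hopp h) t tW Eh.
  by rewrite /flip; case: (harr h); case: (harr _); lia.
have hh b t : t \in W -> (if b then points_in else points_out) _ (og_edge P t.1.2) v ->
   exists2 h, h.1 = t.1.2 & hsrc h = v /\ harr h = b.
  case: b => tW /orP[]/andP[/eqP E1 E2].
  - by exists (t.1.2, true).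
  - by exists (t.1.2, false).
  - by exists (t.1.2, true); rewrite ?/harr /=; split => //; apply/negbTE.
  - by exists (t.1.2, false); rewrite ?/harr /=; split => //; apply/negbTE.
have [[t1 t1W /(hh true _ t1W)[h1 E1 [s1 a1]]] [t2 t2W /(hh false _ t2W)[h2 E2 [s2 a2]]]] := H v vW.
have := key _ _ t1W E1 s1; have := key _ _ t2W E2 s2; rewrite a1 a2 /=.
have [E|] := eqVneq (k v) 0; last by lia.
(* If the maximum is 0, both ends of [h1] have color 0 and their sum is not positive. *)
move=> _ _; have := gk h1; rewrite /within !inE /hval /= s1 E => /(_ isT).
have := hends (hopp h1) _ t1W E1; rewrite E /flip.
by case: (harr h1); case: (harr _); lia.
Qed.

(* If all vertices of A had both kinds of arrows or none, one could walk forever,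
   leaving each vertex by an arrow opposite to the one used to enter it; by
   finiteness this closes up into a cycle. *)
Lemma acyclic_extremal (P : ograph) (A : {set 'I_(og_n P)}) j :
  acyclic P -> within A j ->
  exists2 v, v \in A & extremal A true v != extremal A false v.
Proof.
move=> acP wj.
have [/exists_inP[v vA Hv]|/exists_inPn Hn] :=
  boolP [exists v in A, extremal A true v != extremal A false v]; first by exists v.
(* The half-edge [hopp h] itself refutes one of the two equal flags at its vertex, so both fail and
   an arrow of the other kind exists. *)
have nx (h : 'I_(og_m P) * bool) : within A h.1 ->
    exists h', [&& within A h'.1, hsrc h' == hsrc (hopp h) & harr h' == ~~ harr (hopp h)].
  move=> wh; have vA : hsrc (hopp h) \in A by apply: within_hsrc.
  move: (Hn _ vA); rewrite negbK => /eqP E.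
  have N : ~~ extremal A (harr (hopp h)) (hsrc (hopp h)).
    have : ~~ extremal A (~~ harr (hopp h)) (hsrc (hopp h)).
      apply/forallPn; exists (hopp h); rewrite negb_imply wh eqxx /=.
      by case: (harr _).
    by case: (harr _); rewrite ?E // -E.
  move/forallPn: N => [h']; rewrite negb_imply => /andP[/andP[w1 w2] w3].
  by exists h'; rewrite w1 w2; move: w3; do 2!case: (harr _).
pose f h := odflt h [pick h' | [&& within A h'.1, hsrc h' == hsrc (hopp h) & harr h' == ~~ harr (hopp h)]].
have fP h : within A h.1 -> [&& within A (f h).1, hsrc (f h) == hsrc (hopp h) & harr (f h) == ~~ harr (hopp h)].
  move=> wh; rewrite /f; case: pickP => //= H0; have [h' Hh'] := nx h wh.
  by rewrite H0 in Hh'.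
have [i [n Hn1]] := iter_periodic f (j, true).
set y := iter i f (j, true) in Hn1.
have wit m h : within A h.1 -> within A (iter m f h).1.
  by move=> wh; elim: m => //= m /fP/andP[].
have wy : within A y.1 by apply: wit.
pose g (h : 'I_(og_m P) * bool) := (hsrc h, h.1, hsrc (hopp h)).
have cy : fcycle f (traject f y n.+1).
  rewrite (_ : fcycle f _ = fpath f y (rcons (traject f (f y) n) y)) //.
  rewrite (_ : rcons _ _ = traject f (f y) n.+1); first exact: fpath_traject.
  by rewrite trajectSr -iterSr Hn1.
have wall h : h \in traject f y n.+1 -> within A h.1.
  by move=> /trajectP[m _ ->]; apply: wit.
case: (acP (map g (traject f y n.+1))); split; [split; [|split]|].
- by [].
- rewrite cycle_map.
  apply: (sub_in_cycle (P := [in traject f y n.+1]) _ _ cy); last exact/allP.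
  by move=> h h' hT _ /= /eqP <-; have /and3P[_ /eqP -> _] := fP h (wall _ hT).
- apply/allP => s /mapP[h hT ->]; rewrite /connects /g /hsrc /hopp /=.
  by case: h.2; rewrite !eqxx ?orbT.
move=> v; rewrite -map_comp => /mapP[h hT ->] /=.
have pT : prev (traject f y n.+1) h \in traject f y n.+1 by rewrite mem_prev.
have /eqP Ep := prev_cycle cy hT.
set h' := prev _ h in pT Ep.
have /and3P[_ /eqP E1 /eqP E2] := fP h' (wall _ pT); rewrite /= in Ep; rewrite Ep in E1 E2.
have pin x : harr x -> points_in (og_edge P x.1) (hsrc x).
  by rewrite /harr /points_in /hsrc; case: x.2 => ->; rewrite eqxx ?orbT.
have pout x : ~~ harr x -> points_out (og_edge P x.1) (hsrc x).
  by rewrite /harr /points_out /hsrc; case: x.2 => ->; rewrite eqxx ?orbT.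
have gm x : x \in traject f y n.+1 -> g x \in map g (traject f y n.+1) by exact: map_f.
(* The walk enters this vertex by [hopp h'] and leaves it by [h]; these two arrows are opposite. *)
case Ea : (harr h).
  split; first by exists (g h); [exact: gm|exact: pin].
  exists (g h'); first exact: gm.
  by rewrite E1; apply: (pout (hopp h')); rewrite -E2.
split; last by exists (g h); [exact: gm|apply: pout; rewrite Ea].
exists (g h'); first exact: gm.
by rewrite E1; apply: (pin (hopp h')); rewrite -[harr _]negbK -E2 Ea.
Qed.

(** * Finite differences *)

(* Newton extrapolation to -1: if u is polynomial of degree at most n, then
   extrap n u is the value of that polynomial at -1. *)
Fixpoint extrap (R : nzRingType) (n : nat) (u : nat -> R) : R :=
  if n is n'.+1 then u 0%N - extrap n' (fun m => u m.+1 - u m) else u 0%N.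

(** Only the samples at [0, ..., n] enter, which is why one fixed bound [B] on the colors suffices
    below. *)
Lemma eq_extrap (R : nzRingType) n (u v : nat -> R) :
  (forall m, (m <= n)%N -> u m = v m) -> extrap n u = extrap n v.
Proof.
elim: n u v => [|n IH] u v E /=; first exact: E.
by rewrite E // (IH _ (fun m => v m.+1 - v m)) // => m Hm; rewrite !E // ltnW.
Qed.

Lemma extrapD (R : nzRingType) n (u v : nat -> R) :
  extrap n (fun m => u m + v m) = extrap n u + extrap n v.
Proof.
elim: n u v => [|n IH] u v //=.
rewrite addrACA -opprD -IH; congr (_ - _); apply: eq_extrap => m _.
by rewrite opprD addrACA.
Qed.

Lemma extrapZ (R : comNzRingType) n (a : R) (u : nat -> R) :
  extrap n (fun m => a * u m) = a * extrap n u.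
Proof.
elim: n u => [|n IH] u //=.
rewrite mulrBr -IH; congr (_ - _); apply: eq_extrap => m _.
by rewrite mulrBr.
Qed.

Lemma extrap_cst (R : comNzRingType) n (a : R) : extrap n (fun => a) = a.
Proof.
case: n => [|n] //=; rewrite -[RHS]subr0; congr (_ - _).
rewrite -[RHS](mul0r (extrap n (fun => 0))) -extrapZ; apply: eq_extrap => m _.
by rewrite subrr mul0r.
Qed.

Lemma extrap_sum (R : comNzRingType) n (I : Type) (r : seq I) (p : pred I) (u : I -> nat -> R) :
  extrap n (fun m => \sum_(i <- r | p i) u i m) = \sum_(i <- r | p i) extrap n (u i).
Proof.
elim: r => [|i r IH].
  rewrite big_nil -[RHS](extrap_cst n); apply: eq_extrap => m _; exact: big_nil.
rewrite big_cons -IH (eq_extrap (fun m _ => big_cons _ _ i r p (u^~ m))).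
by case: (p i) => //; exact: extrapD.
Qed.

(** * Bounded colorings and their top blocks *)

(* The colors -B, ..., B, encoded as 0, ..., 2B. *)
Definition cval (B : nat) (i : 'I_B.*2.+1) : int := i%:Z - B%:Z.
Definition cof (B : nat) (x : int) : 'I_B.*2.+1 := inord (absz (x + B%:Z)).

Lemma cofK B x : - B%:Z <= x <= B%:Z -> cval (cof B x) = x.
Proof. by move=> H; rewrite /cval /cof inordK; lia. Qed.

Lemma cval_inj B : injective (@cval B).
Proof. by move=> i j; rewrite /cval => H; apply: val_inj => /=; lia. Qed.

(* Colorings of the graph induced on A with values in [-m, m], extended by 0. *)
Definition colorings (P : ograph) (B m : nat) (A : {set 'I_(og_n P)}) :=
  [set k : {ffun 'I_(og_n P) -> 'I_B.*2.+1} |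
    [forall v, - (m * (v \in A))%:Z <= cval (k v) <= (m * (v \in A))%:Z]
    && good_on A (fun v => cval (k v))].

(* The block of vertices of largest possible absolute value m.+1, with their
   signs. *)
Definition top_block (n B m : nat) (k : {ffun 'I_n -> 'I_B.*2.+1}) : {ffun 'I_n -> option bool} :=
  [ffun v => if cval (k v) == m.+1%:Z then Some true
             else if cval (k v) == - m.+1%:Z then Some false else None].

Definition rest n (A : {set 'I_n}) (t : {ffun 'I_n -> option bool}) :=
  [set v in A | t v == None].

Definition fits (P : ograph) (A : {set 'I_(og_n P)}) v (o : option bool) : bool :=
  if o is Some d then (v \in A) && extremal A d v else true.

Definition admissible (P : ograph) (A : {set 'I_(og_n P)}) (t : {ffun 'I_(og_n P) -> option bool}) :=
  [forall v, fits A v (t v)].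

Definition glue n B m (t : {ffun 'I_n -> option bool}) (k : {ffun 'I_n -> 'I_B.*2.+1}) :=
  [ffun v => if t v is Some d then cof B (flip d m.+1%:Z) else k v].

(** Erased vertices receive 0 because a coloring of [rest A t] must vanish off that set. *)
Definition cut n B (t : {ffun 'I_n -> option bool}) (k : {ffun 'I_n -> 'I_B.*2.+1}) :=
  [ffun v => if t v is Some _ then cof B 0 else k v].

Lemma cof_flipK B m d : (m.+1 <= B)%N -> cval (cof B (flip d m.+1%:Z)) = flip d m.+1%:Z.
Proof. by move=> H; apply: cofK; rewrite /flip; case: d; lia. Qed.

Lemma cof0K B : cval (cof B 0) = 0.
Proof. by apply: cofK; lia. Qed.

Lemma colorings_bound (P : ograph) (B m : nat) (A : {set 'I_(og_n P)}) (k : {ffun 'I_(og_n P) -> 'I_B.*2.+1}) v :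
  k \in colorings B m A -> - m%:Z <= cval (k v) <= m%:Z.
Proof. by rewrite inE => /andP[/forallP /(_ v)]; case: (v \in A) => /=; lia. Qed.

Lemma colorings_off (P : ograph) (B m : nat) (A : {set 'I_(og_n P)}) (k : {ffun 'I_(og_n P) -> 'I_B.*2.+1}) v :
  k \in colorings B m A -> v \notin A -> cval (k v) = 0.
Proof.
rewrite inE => /andP[/forallP /(_ v) H _] /negbTE vA.
by move: H; rewrite vA muln0; lia.
Qed.

Lemma top_block_flip n B m (k : {ffun 'I_n -> 'I_B.*2.+1}) v d :
  (top_block m k v == Some d) = (cval (k v) == flip d m.+1%:Z).
Proof.
rewrite ffunE /flip; case: d; case: (eqVneq (cval (k v)) m.+1%:Z) => // ?.
- by case: ifP.
- by apply/esym/negbTE/eqP; lia.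
- by case: ifP.
Qed.

(** The other end of an edge has value at least [- m.+1], so positivity forces value [m.+1] at the
    top vertex: each of its arrows agrees with its sign. *)
Lemma top_block_admissible (P : ograph) (B m : nat) (A : {set 'I_(og_n P)}) k :
  k \in colorings B m.+1 A -> admissible A (top_block m k).
Proof.
move=> kA; apply/forallP => v; case E: (top_block m k v) => [d|//].
move/eqP: E; rewrite top_block_flip => /eqP E.
have vA : v \in A.
  apply/negP => /negP vA; have := colorings_off kA vA.
  by rewrite E /flip; case: d E; lia.
rewrite /fits vA /=; apply/forallP => h; apply/implyP => /andP[wh /eqP sh].
have gk : good_on A (fun v => cval (k v)) by move: kA; rewrite inE => /andP[].
have := good_onP _ _ gk h wh; rewrite /hval sh E.
have := colorings_bound (hsrc (hopp h)) kA.
by case: (harr h); case: (d); case: (harr _); rewrite /flip /=; lia.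
Qed.

Lemma within_rest (P : ograph) (A : {set 'I_(og_n P)}) t j :
  within (rest A t) j -> within A j.
Proof. by rewrite /within !inE => /andP[/andP[-> _] /andP[-> _]]. Qed.

Lemma cut_rest n B (A : {set 'I_n}) t (k : {ffun 'I_n -> 'I_B.*2.+1}) v :
  v \in rest A t -> cut t k v = k v.
Proof. by rewrite inE ffunE => /andP[_ /eqP ->]. Qed.

Lemma cut_colorings (P : ograph) (B m : nat) (A : {set 'I_(og_n P)}) (k : {ffun 'I_(og_n P) -> 'I_B.*2.+1}) :
  k \in colorings B m.+1 A -> cut (top_block m k) k \in colorings B m (rest A (top_block m k)).
Proof.
move=> kA; rewrite inE; apply/andP; split.
  apply/forallP => v; rewrite ffunE; case E: (top_block m k v) => [d|].
    by rewrite cof0K; lia.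
  have := colorings_bound v kA.
  have := top_block_flip m k v true; have := top_block_flip m k v false; rewrite E /= inE E eqxx andbT.
  case: (boolP (v \in A)) => vA; last by rewrite (colorings_off kA vA); lia.
  by rewrite muln1 /flip => /esym/negbT/eqP ? /esym/negbT/eqP ?; lia.
have gk : good_on A (fun v => cval (k v)) by move: kA; rewrite inE => /andP[].
apply/good_onP => h wh; have := good_onP _ _ gk h (within_rest wh).
have w1 := within_hsrc wh; have w2 := @within_hsrc _ _ (hopp h) wh.
by rewrite /hval !(@cut_rest _ _ A).
Qed.

(** Admissibility gives every half-edge at a block vertex the value [m.+1], while all values are at
    least [- m]. Edges meeting the block are thus satisfied, and the others lie within
    [rest A t]. *)
Lemma glue_colorings (P : ograph) (B m : nat) (A : {set 'I_(og_n P)}) t (k : {ffun 'I_(og_n P) -> 'I_B.*2.+1}) :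
  (m.+1 <= B)%N -> admissible A t ->
  k \in colorings B m (rest A t) -> glue m t k \in colorings B m.+1 A.
Proof.
move=> mB /forallP tA kA; rewrite inE; apply/andP; split.
  apply/forallP => v; rewrite ffunE; move: (tA v); rewrite /fits; case E: (t v) => [d|].
    by move=> /andP[-> _]; rewrite cof_flipK // /flip; case: d {E}; lia.
  move=> _; move: kA; rewrite inE => /andP[/forallP /(_ v)]; rewrite inE E eqxx andbT.
  by case: (v \in A); lia.
have gk : good_on (rest A t) (fun v => cval (k v)) by move: kA; rewrite inE => /andP[].
have val h : within A h.1 -> - m%:Z <= hval (fun v => cval (glue m t k v)) h /\
    (t (hsrc h) != None -> hval (fun v => cval (glue m t k v)) h = m.+1%:Z).
  move=> wh; rewrite /hval ffunE; move: (tA (hsrc h)); rewrite /fits; case: (t (hsrc h)) => [d|_].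
    move=> /andP[_ /forallP /(_ h)]; rewrite wh eqxx => /eqP ->.
    by rewrite cof_flipK // /flip; case: d; lia.
  by have := colorings_bound (hsrc h) kA; rewrite /flip; case: (harr h); split; try lia.
have big_pos (x y : int) : x = m.+1%:Z -> - m%:Z <= y -> 0 < x + y by lia.
apply/good_onP => h wh.
have [v1 v2] := val h wh; have [v3 v4] := val (hopp h) wh.
case: (eqVneq (t (hsrc h)) None) => E1; last exact: (big_pos _ _ (v2 E1) v3).
case: (eqVneq (t (hsrc (hopp h))) None) => E2; last by rewrite addrC; apply: (big_pos _ _ (v4 E2) v1).
have wr : within (rest A t) h.1.
  move: wh E1 E2; rewrite /within !inE.
  by case: h {v1 v2 v3 v4} => j [] /= /andP[-> ->] -> ->.
by have := good_onP _ _ gk h wr; rewrite /hval !ffunE E1 E2.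
Qed.

Lemma glueK (P : ograph) (B m : nat) (A : {set 'I_(og_n P)}) t (k : {ffun 'I_(og_n P) -> 'I_B.*2.+1}) :
  k \in colorings B m (rest A t) -> cut t (glue m t k) = k.
Proof.
move=> kA; apply/ffunP => v; rewrite !ffunE; case E: (t v) => [d|//].
apply: cval_inj; rewrite cof0K (colorings_off kA) // inE E andbF //.
Qed.

Lemma top_block_glue (P : ograph) (B m : nat) (A : {set 'I_(og_n P)}) t (k : {ffun 'I_(og_n P) -> 'I_B.*2.+1}) :
  (m.+1 <= B)%N -> k \in colorings B m (rest A t) -> top_block m (glue m t k) = t.
Proof.
move=> mB kA; apply/ffunP => v; rewrite !ffunE; case E: (t v) => [d|].
  by rewrite cof_flipK // /flip; case: d {E}; rewrite ?eqxx //; case: eqP => //; lia.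
have := colorings_bound v kA.
by case: ifP => [/eqP|_]; [lia|case: ifP => [/eqP|//]; lia].
Qed.

Lemma cutK (n B m : nat) (k : {ffun 'I_n -> 'I_B.*2.+1}) :
  (m.+1 <= B)%N -> glue m (top_block m k) (cut (top_block m k) k) = k.
Proof.
move=> mB; apply/ffunP => v; rewrite [LHS]ffunE; case E: (top_block m k v) => [d|].
  by move/eqP: E; rewrite top_block_flip => /eqP E; apply: cval_inj; rewrite E cof_flipK.
by rewrite ffunE E.
Qed.

(** Over each admissible [t], [cut] and [glue] are inverse bijections between the fibre of
    [top_block] and the colorings of the rest. [G] is 1 for plain counting and later carries the
    weights that mark sinks. *)
Lemma top_decomposition (R : nzRingType) (P : ograph) (B m : nat) (A : {set 'I_(og_n P)})
    (G : {ffun 'I_(og_n P) -> option bool} -> R) :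
  (m.+1 <= B)%N ->
  \sum_(k in colorings B m.+1 A) G (top_block m k) =
  \sum_(t | admissible A t) G t * #|colorings B m (rest A t)|%:R.
Proof.
move=> mB; rewrite (partition_big (@top_block _ B m) (admissible A)) => [|k]; last exact: top_block_admissible.
apply: eq_bigr => t tA.
rewrite (eq_bigr (fun=> G t)) => [|k /andP[_ /eqP-> //]].
rewrite (reindex_onto (glue m t) (cut t)) => [|k /andP[_ /eqP <-]]; last exact: cutK.
rewrite (eq_bigl [in colorings B m (rest A t)]); first by rewrite sumr_const mulr_natr.
move=> k; apply/andP/idP => [[/andP[kA /eqP tk] /eqP kk]|kA].
  by have := cut_colorings kA; rewrite tk kk.
by rewrite (glueK kA) (top_block_glue mB kA) (glue_colorings mB tA kA) !eqxx.
Qed.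

(** Only the zero coloring is in range, and it violates the strict inequality of any edge. *)
Lemma colorings0 (P : ograph) (B : nat) (A : {set 'I_(og_n P)}) :
  #|colorings B 0 A| = ~~ [exists j, within A j].
Proof.
have Hc (k : {ffun 'I_(og_n P) -> 'I_B.*2.+1}) : k \in colorings B 0 A -> k = [ffun=> cof B 0].
  move=> kA; apply/ffunP => v; rewrite ffunE; apply: cval_inj.
  by rewrite cof0K; apply/esym/le_anti; have := colorings_bound v kA; rewrite oppr0.
case: (boolP [exists j, within A j]) => [/existsP[j wj]|/existsPn H].
  apply/eqP; rewrite cards_eq0; apply/eqP/setP => k; rewrite in_set0; apply/negP => kA.
  have E := Hc _ kA; move: kA; rewrite inE => /andP[_ /forallP /(_ j)]; rewrite wj /= E /hval !ffunE.
  by rewrite cof0K /flip; do 2 case: (harr _); rewrite ?oppr0 addr0.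
rewrite (_ : colorings B 0 A = [set [ffun=> cof B 0]]) ?cards1 //; apply/setP => k; rewrite in_set1.
apply/idP/eqP => [/Hc //|->]; rewrite inE; apply/andP; split.
  by apply/forallP => v; rewrite ffunE cof0K; lia.
by apply/forallP => j; rewrite (negbTE (H j)).
Qed.

(** * Signed sums over blocks and the value at -1 *)

Lemma big_option_bool (R : nzRingType) (F : option bool -> R) :
  \sum_o F o = F None + (F (Some true) + F (Some false)).
Proof.
rewrite (bigD1 None) //= (bigD1 (Some true)) //= (bigD1 (Some false)) //= big1 ?addr0 //.
by case=> [[]|].
Qed.

(** Admissibility is tested vertex by vertex, so the sum distributes into a product of local
    sums. *)
Lemma sum_admissible (R : comNzRingType) (P : ograph) (A : {set 'I_(og_n P)}) (F : 'I_(og_n P) -> option bool -> R) :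
  \sum_(t : {ffun 'I_(og_n P) -> option bool} | admissible A t) \prod_v F v (t v) =
  \prod_v (F v None + (((v \in A) && extremal A true v)%:R * F v (Some true)
     + ((v \in A) && extremal A false v)%:R * F v (Some false))).
Proof.
pose H v o := (fits A v o)%:R * F v o.
transitivity (\prod_v \sum_o H v o); last first.
  by apply: eq_bigr => v _; rewrite big_option_bool /H mul1r.
rewrite bigA_distr_bigA /= big_mkcond; apply: eq_bigr => t _.
rewrite /H big_split /= ; case: (boolP (admissible A t)) => [/forallP Ht|/forallPn[v Hv]].
  by rewrite [X in X * _]big1 ?mul1r // => v _; rewrite Ht.
by rewrite [X in X * _](bigD1 v) //= (negbTE Hv) !mul0r.
Qed.

Lemma sign_rest (R : comNzRingType) n (A : {set 'I_n}) t :
  (-1) ^+ #|rest A t| = \prod_v (if (v \in A) && (t v == None) then -1 else 1 : R).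
Proof.
by rewrite -big_mkcond /= -prodr_const; apply: eq_bigl => v; rewrite !inE.
Qed.

Lemma rest_none n (A : {set 'I_n}) : rest A [ffun=> None] = A.
Proof. by apply/setP => v; rewrite inE ffunE eqxx andbT. Qed.

(* The sum factors over the vertices of A: a vertex that is both a sink and a
   source contributes 1, one that is exactly one of them contributes 0. *)
Lemma sum_sign_rest (R : comNzRingType) (P : ograph) (A : {set 'I_(og_n P)}) :
  acyclic P ->
  \sum_(t | admissible A t) (-1) ^+ #|rest A t| = (~~ [exists j, within A j])%:R :> R.
Proof.
move=> acP.
under eq_bigr do rewrite sign_rest.
rewrite (sum_admissible A (fun v o => if (v \in A) && (o == None) then -1 else 1)).
case: (boolP [exists j, within A j]) => [/existsP[j wj]|/existsPn H].
  have [v vA Hv] := acyclic_extremal acP wj.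
  rewrite (bigD1 v) //= vA /= (_ : -1 + _ = 0) ?mul0r //.
  by move: Hv; do 2 case: (extremal _ _ _) => //; rewrite ?mul1r ?mul0r ?add0r ?addr0 ?addNr.
rewrite big1 // => v _; rewrite !andbF; case: (boolP (v \in A)) => vA /=; last by rewrite !mul0r !addr0.
have ext d : extremal A d v.
  by apply/forallP => h; rewrite (negbTE (H _)).
by rewrite !ext !mulr1 addKr.
Qed.

(* The Euler characteristic of the open cone cut out by an acyclic orientation. *)
Lemma extrap_colorings (R : comNzRingType) (P : ograph) (B : nat) n (A : {set 'I_(og_n P)}) :
  acyclic P -> (n <= B)%N -> (#|A| <= n)%N ->
  extrap n (fun m => #|colorings B m A|%:R) = (-1) ^+ #|A| :> R.
Proof.
move=> acP; elim: n A => [|n IH] A nB An /=.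
  rewrite colorings0.
  have A0 : A = set0 by apply/eqP; rewrite -cards_eq0 -leqn0.
  rewrite A0 cards0 (_ : [exists j, _] = false) //.
  by apply/existsP => -[j]; rewrite /within inE.
rewrite (@eq_extrap _ _ _ (fun m => \sum_(t | admissible A t && (t != [ffun=> None]))
    #|colorings B m (rest A t)|%:R)); last first.
  move=> m mn; have mB : (m.+1 <= B)%N by apply: leq_ltn_trans nB.
  have := top_decomposition (R := R) A (fun=> 1) mB; rewrite sumr_const => ->.
  (* The empty block accounts for the colorings with bound [m], so the difference only involves
     proper subsets of [A]. *)
  rewrite (bigD1 [ffun=> None]) /=; last by apply/forallP => v; rewrite ffunE.
  rewrite rest_none mul1r addrC addrK.
  by apply: eq_bigr => t _; rewrite mul1r.
rewrite extrap_sum (eq_bigr (fun t => (-1) ^+ #|rest A t|)); last first.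
  move=> t /andP[tA tn]; apply: IH; first exact: ltnW.
  have [v Hv] : exists v, t v != None.
    apply/existsP; apply: contraNT tn => /existsPn H; apply/eqP/ffunP => v.
    by rewrite ffunE; apply/eqP; rewrite -[_ == _]negbK H.
  rewrite -ltnS; apply: leq_trans An; apply: proper_card; apply/properP; split.
    by apply/subsetP => u; rewrite inE => /andP[].
  exists v; last by rewrite inE (negbTE Hv) andbF.
  by move/forallP: tA => /(_ v); rewrite /fits; case: (t v) Hv => // d _ /andP[].
rewrite colorings0.
(* The signed sum over all blocks equals the sample at 0; subtracting the nonempty blocks leaves the
   empty one, [(-1) ^+ #|A|]. *)
have := sum_sign_rest R A acP; rewrite (bigD1 [ffun=> None]) /=; last by apply/forallP => v; rewrite ffunE.
by rewrite rest_none => <-; rewrite addrK.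
Qed.

(** * Coefficients of [Y_P] as sums over colorings *)

Definition vals n B (k : {ffun 'I_n -> 'I_B.*2.+1}) : seq int :=
  [seq cval (k v) | v <- enum 'I_n].

Lemma size_vals n B (k : {ffun 'I_n -> 'I_B.*2.+1}) : size (vals k) = n.
Proof. by rewrite size_map size_enum_ord. Qed.

Lemma nth_vals n B (k : {ffun 'I_n -> 'I_B.*2.+1}) (v : 'I_n) : nth 0 (vals k) v = cval (k v).
Proof. by rewrite (nth_map v) ?size_enum_ord // nth_ord_enum. Qed.

Lemma vals_inj n B : injective (@vals n B).
Proof.
move=> k k' E; apply/ffunP => v; apply: cval_inj.
by rewrite -!nth_vals E.
Qed.

(** A rearrangement uses the same colors, so it stays in range and comes from a unique coloring. *)
Lemma permutations_vals n B (k : {ffun 'I_n -> 'I_B.*2.+1}) :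
  perm_eq (permutations (vals k)) [seq vals k' | k' <- enum [pred k' | perm_eq (@vals n B k') (vals k)]].
Proof.
apply: uniq_perm; rewrite ?permutations_uniq ?(map_inj_uniq (@vals_inj n B)) ?enum_uniq // => l.
rewrite mem_permutations; apply/idP/mapP => [lk|[k' + ->]]; last by rewrite mem_enum.
have sl : size l = n by rewrite (perm_size lk) size_vals.
have E : l = vals [ffun v : 'I_n => cof B (nth 0 l v)].
  apply: (@eq_from_nth _ 0); first by rewrite size_vals.
  rewrite sl => i ni.
  rewrite -[i]/(val (Ordinal ni)) nth_vals ffunE cofK //.
  have : nth 0 l i \in vals k by rewrite -(perm_mem lk) mem_nth // sl.
  by move=> /mapP[v _ /= ->]; have := ltn_ord (k v); rewrite /cval; lia.
by exists [ffun v : 'I_n => cof B (nth 0 l v)]; rewrite // mem_enum inE -E.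
Qed.

Lemma Ycoef_vals (P : ograph) B (k : {ffun 'I_(og_n P) -> 'I_B.*2.+1}) :
  Ycoef P (vals k) =
  \sum_(k' | perm_eq (@vals (og_n P) B k') (vals k)) (good_coloring (P := P) (fun v => cval (k' v)))%:R.
Proof.
rewrite /Ycoef size_vals eqxx (permP (permutations_vals k)) count_map -sum1_count natr_sum.
rewrite big_enum_cond /= big_mkcondr /=; apply: eq_bigr => k' _.
rewrite (_ : good_coloring _ = good_coloring (P := P) (fun v => cval (k' v))); first by case: ifP.
by apply: eq_forallb => j /=; rewrite !nth_vals.
Qed.

Lemma size_permutations_vals n B (k : {ffun 'I_n -> 'I_B.*2.+1}) :
  size (permutations (vals k)) = #|[pred k' | perm_eq (@vals n B k') (vals k)]|.
Proof. by rewrite (perm_size (permutations_vals k)) size_map -cardE. Qed.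

(** * The linear functional that counts sinks *)

(* Colors lie in [-m, m.+1]; those equal to m.+1 mark a set S of sinks. *)
Definition weight (m : nat) (x : int) : {poly rat} :=
  if x == m.+1%:Z then 1 - 'X else (- m%:Z <= x <= m%:Z)%R%:R.

(* Division by the number of rearrangements makes the sum run over monomials
   rather than over colorings. *)
Definition sink_poly (n : nat) (f : series) : {poly rat} :=
  (-1) ^+ n * extrap n (fun m => \sum_(k : {ffun 'I_n -> 'I_n.+1.*2.+1})
    (f (vals k) / (size (permutations (vals k)))%:R) *: \prod_(x <- vals k) weight m x).

(** Only monomials of degree [n] are seen, which later separates graphs by their number of
    vertices. *)
Lemma sink_poly_eq0 n f : (forall s, size s = n -> f s = 0) -> sink_poly n f = 0.
Proof.
move=> H; rewrite /sink_poly (@eq_extrap _ _ _ (fun=> 0)) ?extrap_cst ?mulr0 // => m _.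
by rewrite big1 // => k _; rewrite H ?size_vals // mul0r scale0r.
Qed.

Lemma sink_poly_sum n (I : Type) (r : seq I) (c : I -> rat) (g : I -> series) f :
  (forall s, f s = \sum_(i <- r) c i * g i s) ->
  sink_poly n f = \sum_(i <- r) c i *: sink_poly n (g i).
Proof.
move=> H; rewrite /sink_poly.
under [RHS]eq_bigr do rewrite -mul_polyC mulrCA.
rewrite -mulr_sumr; congr (_ * _).
under [RHS]eq_bigr do rewrite -extrapZ.
rewrite -extrap_sum; apply: eq_extrap => m _.
under [RHS]eq_bigr do rewrite mulr_sumr.
rewrite exchange_big; apply: eq_bigr => k _ /=.
rewrite H mulr_suml scaler_suml; apply: eq_bigr => i _.
by rewrite mul_polyC scalerA mulrA.
Qed.

(** After exchanging sums, each good coloring occurs once per coloring with the same multiset of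
    values; the division cancels this multiplicity. *)
Lemma sum_Ycoef (R : lmodType rat) (P : ograph) B (w : seq int -> R) :
  (forall s t, perm_eq s t -> w s = w t) ->
  \sum_(k : {ffun 'I_(og_n P) -> 'I_B.*2.+1})
    (Ycoef P (vals k) / (size (permutations (vals k)))%:R) *: w (vals k) =
  \sum_(k : {ffun 'I_(og_n P) -> 'I_B.*2.+1} | good_coloring (P := P) (fun v => cval (k v))) w (vals k).
Proof.
move=> wP.
under eq_bigr do rewrite Ycoef_vals mulr_suml scaler_suml.
rewrite (exchange_big_dep predT) //= [RHS]big_mkcond; apply: eq_bigr => k' _.
rewrite (eq_bigr (fun=> ((good_coloring (P := P) (fun v => cval (k' v)))%:R /
   (size (permutations (vals k')))%:R) *: w (vals k'))); last first.
  move=> k kk; rewrite (wP _ _ kk); congr ((_ / _%:R) *: _).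
  rewrite !size_permutations_vals; apply: eq_card => k2; rewrite !inE.
  by rewrite (permPr kk).
rewrite (eq_bigl [pred k | perm_eq (vals k) (vals k')]); last by move=> k; rewrite perm_sym.
rewrite sumr_const -size_permutations_vals -scaler_nat scalerA mulrCA mulfV ?mulr1.
  by case: ifP => _; rewrite ?scale1r ?scale0r.
rewrite pnatr_eq0 size_permutations_vals -lt0n; apply/card_gt0P; exists k'.
by rewrite inE.
Qed.

(** The color [- m.+1] is outside the asymmetric range of [weight], hence the 0. *)
Definition top_weight (o : option bool) : {poly rat} :=
  if o is Some d then (if d then 1 - 'X else 0) else 1.

Lemma weight_out m (x : int) : ~~ (- m.+1%:Z <= x <= m.+1%:Z) -> weight m x = 0.
Proof.
rewrite /weight; case: eqP => [->|_ H]; first by lia.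
by rewrite (_ : _ <= x <= _ = false) //; lia.
Qed.

Lemma weight_top m (x : int) : - m.+1%:Z <= x <= m.+1%:Z ->
  weight m x = top_weight (if x == m.+1%:Z then Some true
                           else if x == - m.+1%:Z then Some false else None).
Proof.
rewrite /weight; case: eqP => // n1; case: eqP => [->|n2] H.
  by rewrite (_ : _ <= _ <= _ = false) //; lia.
by rewrite (_ : _ <= x <= _ = true) //; lia.
Qed.

Lemma sum_weight_colorings (P : ograph) B m :
  is_orientation P -> (m.+1 <= B)%N ->
  \sum_(k : {ffun 'I_(og_n P) -> 'I_B.*2.+1} | good_coloring (P := P) (fun v => cval (k v)))
     \prod_(x <- vals k) weight m x =
  \sum_(k in colorings B m.+1 [set: 'I_(og_n P)]) \prod_v top_weight (top_block m k v).
Proof.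
move=> oP mB; rewrite [LHS]big_mkcond [RHS]big_mkcond; apply: eq_bigr => k _.
rewrite inE -good_coloringE // andbC; case: (good_coloring _) => //=.
rewrite big_map big_enum /=.
case: (boolP [forall v, _]) => [/forallP H|/forallPn[v Hv]]; last first.
  by rewrite (bigD1 v) //= weight_out ?mul0r //; move: Hv; rewrite inE muln1.
apply: eq_bigr => v _; rewrite ffunE; apply: weight_top.
by move: (H v); rewrite inE muln1.
Qed.

(** With the global sign distributed over the vertices, a sink contributes [- (-1 + (1 - 'X)) = 'X]
    and any other vertex [- (-1) = 1]. *)
Lemma sink_poly_Ycoef (P : ograph) : signed_poset P -> sink_poly (og_n P) (Ycoef P) = 'X^(nsinks P).
Proof.
move=> [oP acP]; rewrite /sink_poly.
(* The color bound [(og_n P).+1] leaves room for the color [m.+1] at every sample [m <= og_n P]. *)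
rewrite (@eq_extrap _ _ _ (fun m => \sum_(t | admissible [set: 'I_(og_n P)] t)
   (\prod_v top_weight (t v)) * #|colorings (og_n P).+1 m (rest setT t)|%:R)); last first.
  move=> m mn; rewrite (@sum_Ycoef _ P _ (fun s => \prod_(x <- s) weight m x)); last first.
    by move=> s t st; apply: perm_big.
  rewrite sum_weight_colorings // -top_decomposition //.
rewrite extrap_sum.
rewrite (eq_bigr (fun t : {ffun _} => (\prod_v (top_weight (t v) * (if t v == None then -1 else 1))))); last first.
  move=> t _; rewrite extrapZ extrap_colorings //; last by rewrite -[X in (_ <= X)%N]card_ord max_card.
  by rewrite [RHS]big_split sign_rest; congr (_ * _); apply: eq_bigr => v _; rewrite inE.
rewrite (sum_admissible setT (fun v o => top_weight o * (if o == None then -1 else 1))) /=.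
have -> : 'X^(nsinks P) = \prod_v (if @is_sink P v then 'X else 1) :> {poly rat}.
  by rewrite -big_mkcond prodr_const.
have -> : (-1) ^+ og_n P = \prod_(v : 'I_(og_n P)) -1 :> {poly rat}.
  by rewrite prodr_const card_ord.
rewrite -big_split /=; apply: eq_bigr => v _.
by rewrite inE sinkE /= mul0r mulr0 addr0; case: (extremal _ _ _) => /=; ring.
Qed.

(** * The functional on [p_{a,0}] *)

Lemma perm_eq_nseq (T : eqType) n (x : T) s : perm_eq s (nseq n x) -> s = nseq n x.
Proof.
move=> H; have /all_pred1P -> : all (pred1 x) s.
  by rewrite (perm_all _ H) all_nseq /= eqxx orbT.
by rewrite (perm_size H) size_nseq.
Qed.

(** Since [a > 0], the empty monomial, where [head] returns its default, gives 0 on both sides. *)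
Lemma pab0E a s : (0 < a)%N -> pab a 0 s = (s == nseq a (head 0 s))%:R.
Proof.
move=> a0; rewrite /pab.
have E i : perm_eq s (nseq a i ++ [::]) = (s == nseq a i).
  by rewrite cats0; apply/idP/eqP => [/perm_eq_nseq|->].
case: (eqVneq s (nseq a (head 0 s))) => [Es|Ns]; last first.
  rewrite (eq_count (a2 := pred0)) ?count_pred0 // => i /=; rewrite E.
  apply: contraNF Ns => /eqP Ei; rewrite {1}Ei; apply/eqP; congr nseq.
  by rewrite Ei; case: (a) a0.
rewrite (eq_count (a2 := pred1 (head 0 s))); last first.
  move=> i /=; rewrite E Es; case: (a) a0 => // a' _ /=.
  by rewrite eqseq_cons; case: eqVneq => [->|] //=; rewrite ?eqxx // eq_sym => /negbTE.
rewrite count_uniq_mem ?undup_uniq // mem_undup mem_cat.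
by rewrite {2}Es; case: (a) a0 => // a' _; rewrite mem_head.
Qed.

Lemma sum_interval B m : (m <= B)%N ->
  \sum_(c : 'I_B.*2.+1) ((- m%:Z <= cval c <= m%:Z)%R%:R : {poly rat}) = (m.*2.+1)%:R.
Proof.
move=> mB; rewrite -natr_sum; congr _%:R.
rewrite (eq_bigr (fun c : 'I_B.*2.+1 => ((B - m <= c) && (c < B + m.+1))%N : nat)); last first.
  by move=> c _; congr (nat_of_bool _); rewrite /cval; lia.
rewrite -(big_mkord xpredT (fun c => ((B - m <= c) && (c < B + m.+1))%N : nat)).
rewrite (@big_cat_nat _ _ _ (B - m)) /=; try lia.
rewrite (@big_cat_nat _ _ _ (B + m.+1) (B - m)) /=; try lia.
rewrite big_nat_cond big1 => [|c]; last by lia.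
rewrite big_nat_cond (eq_bigr (fun=> 1%N)) => [|c]; last by lia.
rewrite -big_nat_cond sum_nat_const_nat.
rewrite big_nat_cond big1 => [|c]; last by lia.
by lia.
Qed.

(** Only constant colorings contribute. Each is its own sole rearrangement and gives the [a]-th
    power of one weight. *)
Lemma sink_poly_pab a : (0 < a)%N -> sink_poly a (pab a 0) = ('X - 1) ^+ a - ((-1) ^+ a)%:P.
Proof.
move=> a0; rewrite /sink_poly.
rewrite (@eq_extrap _ _ _ (fun m => (m.*2.+1)%:R + (1 - 'X) ^+ a)); last first.
  move=> m ma; have mB : (m.+1 <= a.+1)%N by [].
  case: a a0 ma mB => // a _ ma mB.
  rewrite (partition_big (fun k : {ffun 'I_a.+1 -> 'I_a.+2.*2.+1} => k ord0) xpredT) //=.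
  rewrite (eq_bigr (fun c => weight m (cval c) ^+ a.+1)); last first.
    move=> c _; rewrite (bigD1 [ffun=> c]) ?ffunE //= [X in _ + X]big1 ?addr0; last first.
      move=> k /andP[/eqP k0 kc]; rewrite pab0E // [_ == _](_ : _ = false) ?mul0r ?scale0r //.
      apply: contraNF kc => /eqP H; apply/eqP/ffunP => v; apply: cval_inj.
      rewrite ffunE -nth_vals H nth_nseq ltn_ord -nth0 -[0%N]/(val (ord0 : 'I_a.+1)) nth_vals k0 //.
    have V : vals ([ffun=> c] : {ffun 'I_a.+1 -> 'I_a.+2.*2.+1}) = nseq a.+1 (cval c).
      apply: (@eq_from_nth _ 0); first by rewrite size_vals size_nseq.
      rewrite size_vals => i ni.
      by rewrite -[i]/(val (Ordinal ni)) nth_vals ffunE nth_nseq ni.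
    rewrite size_permutations_vals (eq_card1 (x := [ffun=> c])) => [|k]; last first.
      rewrite !inE V; apply/idP/eqP => [H|->]; last by rewrite V.
      by apply: vals_inj; rewrite V; exact: perm_eq_nseq.
    rewrite V pab0E // eqxx divr1 scale1r big_nseq.
    exact: iter_mulr_1.
  rewrite (bigD1 (cof a.+2 m.+1%:Z)) //= addrC.
  have cm : cval (cof a.+2 m.+1%:Z) = m.+1%:Z by apply: cofK; lia.
  rewrite {2}/weight cm eqxx; congr (_ + _).
  rewrite -(@sum_interval a.+2) ?(ltnW mB) // [RHS](bigD1 (cof a.+2 m.+1%:Z)) //= cm.
  rewrite [_ && _](_ : _ = false) ?add0r; last by lia.
  apply: eq_bigr => c cN; rewrite /weight ifF.
    by case: (_ && _); rewrite ?expr1n ?expr0n.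
  by apply: contraNF cN => /eqP H; apply/eqP/cval_inj; rewrite cm.
rewrite extrapD extrap_cst.
have -> : extrap a (fun m => (m.*2.+1)%:R) = -1 :> {poly rat}.
  (* The sample at 0 is 1 and the difference is constantly 2, so the value at -1 is [1 - 2]. *)
  case: a a0 => // a _ /=; rewrite (@eq_extrap _ _ _ (fun=> 2)) ?extrap_cst => [|m _]; first by rewrite double0; ring.
  by rewrite doubleS -addn2 natrD -addrA -addn1 addrC; ring.
rewrite mulrDr -exprMn mulN1r opprB mulrN1 addrC; congr (_ - _).
by rewrite rmorphXn rmorphN1.
Qed.

(** * Membership of [p_{a,0}] in the span *)

Definition graph_of a (l : seq (sedge a)) := OGraph (fun j => tnth (in_tuple l) j).

Definition good_edge a (k : 'I_a -> int) (e : sedge a) :=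
  [&& k (e_u e) != sgnz (e_pos e) * k (e_v e),
      e_au e == (sgnz (e_pos e) * k (e_v e) < k (e_u e)) &
      e_av e == (sgnz (e_pos e) * k (e_u e) < k (e_v e))].

Definition arc a (p : 'I_a * 'I_a) (b : bool) := SEdge p.1 p.2 true (~~ b) b.

Lemma good_graph_of a (l : seq (sedge a)) (k : 'I_a -> int) :
  good_coloring (P := graph_of l) k = all (good_edge k) l.
Proof.
rewrite -(forallb_tnth _ (in_tuple l)); apply: eq_forallb => j /=.
by rewrite /good_edge andbA.
Qed.

Lemma good_arc a (p : 'I_a * 'I_a) b (k : 'I_a -> int) :
  good_edge k (arc p b) = if b then k p.1 < k p.2 else k p.2 < k p.1.
Proof. by rewrite /good_edge /= !mul1r; case: b => /=; case: ltgtP. Qed.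

(* On colorings, [k i = k j] = 1 - [k i < k j] - [k i > k j]; multiply out over s. *)
Fixpoint expansion a (s : seq ('I_a * 'I_a)) : seq (rat * seq (sedge a)) :=
  if s is p :: s' then
    expansion s' ++ [seq (- x.1, arc p true :: x.2) | x <- expansion s']
                 ++ [seq (- x.1, arc p false :: x.2) | x <- expansion s']
  else [:: (1, [::])].

Lemma sum_expansion a (s : seq ('I_a * 'I_a)) (k : 'I_a -> int) :
  \sum_(x <- expansion s) x.1 * (all (good_edge k) x.2)%:R =
  (all (fun p => k p.1 == k p.2) s)%:R.
Proof.
elim: s => [|p s IH] /=; first by rewrite big_seq1 mulr1.
have E b : \sum_(x <- [seq (- x.1, arc p b :: x.2) | x <- expansion s])
    x.1 * (all (good_edge k) x.2)%:R =
    - ((good_edge k (arc p b))%:R * (all (fun p => k p.1 == k p.2) s)%:R) :> rat.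
  rewrite big_map -IH mulr_sumr -sumrN; apply: eq_bigr => x _ /=.
  by rewrite -mulnb natrM mulNr mulrCA.
rewrite !big_cat /= !E IH !good_arc.
by case: ltgtP => _ /=; rewrite ?mul1r ?mul0r; case: all; rewrite ?oppr0 ?add0r ?addr0 ?subrr.
Qed.

Lemma expansion_orientation a (s : seq ('I_a * 'I_a)) :
  all (fun x => is_orientation (graph_of x.2)) (expansion s).
Proof.
have E l : is_orientation (graph_of l) = all (fun e : sedge a => e_pos e == (e_au e != e_av e)) l.
  by rewrite -(forallb_tnth _ (in_tuple l)).
under eq_all do rewrite E; elim: s => //= p s IH.
by rewrite !all_cat !all_map !IH.
Qed.

(** The test is the existence of a good coloring: if there is one, [good_on_acyclic] gives
    acyclicity; if not, [Ycoef] vanishes and the term is dropped. *)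
Lemma prune_nonacyclic (r : seq (rat * ograph)) :
  all (fun x => is_orientation x.2) r ->
  exists2 r' : seq (rat * ograph),
    foldr (fun x (Q : Prop) => signed_poset x.2 /\ Q) True r' &
    forall s, \sum_(x <- r') x.1 * Ycoef x.2 s = \sum_(x <- r) x.1 * Ycoef x.2 s.
Proof.
elim: r => [|x r IH] /=; first by exists [::].
move=> /andP[ox /IH[r' H' E']].
case: (classic (exists k, @good_coloring x.2 k)) => [[k gk]|N].
  exists (x :: r'); last by move=> s; rewrite !big_cons E'.
  split=> //; split=> //; apply: (@good_on_acyclic _ k).
  by rewrite -good_coloringE.
exists r' => // s; rewrite big_cons E' /Ycoef; case: ifP => _; last by rewrite mulr0 add0r.
rewrite (@eq_count _ _ pred0) ?count_pred0 ?mulr0 ?add0r // => l /=.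
by apply/negP => gl; apply: N; exists (fun i => nth 0 l i).
Qed.

Lemma pab_represented a : (0 < a)%N -> exists r, represents r (pab a 0).
Proof.
case: a => // a _.
(* Comparing every vertex with vertex 0 forces a constant coloring. The pair [(ord0, ord0)] only
   creates positive loops, which admit no good coloring and get pruned. *)
pose star := [seq (i, ord0 : 'I_a.+1) | i <- enum 'I_a.+1].
have [|r H E] := @prune_nonacyclic [seq (x.1, graph_of x.2) | x <- expansion star].
  by rewrite all_map; exact: expansion_orientation.
exists r; split=> // s; rewrite E big_map /= pab0E //.
have [sa|sa] := eqVneq (size s) a.+1; last first.
  rewrite big1 => [|x _]; last by rewrite /Ycoef /= (negbTE sa) mulr0.
  by case: eqP => // Es; rewrite Es size_nseq eqxx in sa.
have const l : size l = a.+1 ->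
    all (fun p : 'I_a.+1 * 'I_a.+1 => nth 0 l p.1 == nth 0 l p.2) star = (l == nseq a.+1 (head 0 l)).
  move=> sl; rewrite all_map; apply/allP/eqP => [Hl|El i _ /=]; last first.
    by rewrite El !nth_nseq !ltn_ord.
  apply: (@eq_from_nth _ 0); first by rewrite size_nseq.
  rewrite sl => i ia; rewrite nth_nseq ia -nth0; apply/eqP.
  by apply: (Hl (Ordinal ia)); rewrite mem_enum.
under eq_bigr do rewrite /Ycoef /= sa eqxx -sum1_count natr_sum mulr_sumr big_mkcond /=.
rewrite exchange_big /=.
(* A constant rearrangement of [s] must be [s] itself. *)
rewrite (eq_big_seq (fun l => (l == s)%:R * (s == nseq a.+1 (head 0 s))%:R)) => [|l].
  rewrite -mulr_suml (_ : \sum_(_ <- _) _ = 1) ?mul1r //.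
  rewrite -natr_sum -big_mkcond /= sum1_count count_uniq_mem ?permutations_uniq //.
  by rewrite mem_permutations perm_refl.
rewrite mem_permutations => ls.
transitivity ((l == nseq a.+1 (head 0 l))%:R : rat).
  rewrite -const ?(perm_size ls) // -(sum_expansion star (fun i : 'I_a.+1 => nth 0 l i)); apply: eq_bigr => x _.
  by rewrite good_graph_of; case: all; rewrite ?mulr1 ?mulr0.
have [->|Nl] := eqVneq l s; first by rewrite mul1r.
rewrite mul0r; case: eqP => // El; case/eqP: Nl.
by move: ls; rewrite El perm_sym => /perm_eq_nseq.
Qed.

(** * Summation over degrees and conclusion *)

Lemma sum_sink_poly (ns : seq nat) (r : seq (rat * ograph)) :
  uniq ns -> all (fun x => og_n x.2 \in ns) r ->
  foldr (fun x (Q : Prop) => signed_poset x.2 /\ Q) True r ->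
  \sum_(n <- ns) \sum_(x <- r) x.1 *: sink_poly n (Ycoef x.2) = phi_comb r.
Proof.
move=> uns nr Hr; rewrite exchange_big /= /phi_comb.
elim: r nr Hr => [|x r IH] /=; first by rewrite !big_nil.
move=> /andP[xn nr] [sx Hr]; rewrite !big_cons IH //; congr (_ + _).
rewrite (bigD1_seq (og_n x.2)) //= sink_poly_Ycoef // big1 ?addr0 // => n nx.
rewrite sink_poly_eq0 ?scaler0 // => s sn; rewrite /Ycoef ifF // sn.
exact: negbTE.
Qed.

Theorem theorem6p5 (a : nat) : (1 <= a)%N ->
  (exists r, represents r (pab a 0)) /\
  (forall r, represents r (pab a 0) ->
     phi_comb r = ('X - 1) ^+ a - ((-1) ^+ a)%:P).
Proof.
move=> a1; split=> [|r [Hr Er]]; first exact: pab_represented.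
(* A representation may involve graphs of other sizes; in those degrees [p_{a,0}] vanishes, so their
   contributions cancel. *)
pose ns := undup (a :: [seq og_n x.2 | x <- r]).
have nsr : all (fun x => og_n x.2 \in ns) r.
  rewrite -(all_map (fun x : rat * ograph => og_n x.2) [in ns]).
  by apply/allP => n nr; rewrite /= mem_undup inE nr orbT.
rewrite -(sum_sink_poly _ nsr Hr) ?undup_uniq //.
under eq_bigr do rewrite -(sink_poly_sum _ Er).
rewrite (bigD1_seq a) ?undup_uniq ?mem_undup ?mem_head //= sink_poly_pab //.
rewrite big1 ?addr0 // => n na; apply: sink_poly_eq0 => s sn; rewrite pab0E //.
by case: eqP => // Es; rewrite -sn Es size_nseq eqxx in na.
Qed.
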